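(* An $\aleph$-space $X$ is metrizable if and only if $X$ is a Fréchet–Urysohn space having property $(\alpha_4)$.
   Context: A $k$-network in $X$ is a family $\mathcal N$ of subsets such that whenever $K\subset U$ with $K$ compact and $U$ open, there is a finite $\mathcal F\subset\mathcal N$ with $K\subset\bigcup\mathcal F\subset U$; an $\aleph$-space is a regular space with a $\sigma$-locally finite $k$-network. $X$ has property $(\alpha_4)$ at $x\in X$ if for any family $\{x_{m,n}:(m,n)\in\mathbb N\times\mathbb N\}\subset X$ with $\lim_n x_{m,n}=x$ for every $m$, there exist a sequence $(m_k)_k$ of distinct natural numbers and a sequence $(n_k)_k$ of natural numbers with $\lim_k x_{m_k,n_k}=x$; $X$ has property $(\alpha_4)$ if it has it at every point. *)

(* Defs.v *)
From Stdlib Require Import Reals List.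
Open Scope R_scope.

Set Implicit Arguments.

Record topology (X : Type) := {
  is_open : (X -> Prop) -> Prop;
  open_full : is_open (fun _ => True);
  open_union : forall (F : (X -> Prop) -> Prop),
      (forall U, F U -> is_open U) ->
      is_open (fun x => exists U, F U /\ U x);
  open_inter : forall U V, is_open U -> is_open V ->
      is_open (fun x => U x /\ V x)
}.

Section Top.
Variables (X : Type) (T : topology X).

Definition is_closed (C : X -> Prop) : Prop := is_open T (fun x => ~ C x).

Definition closure (A : X -> Prop) (x : X) : Prop :=
  forall U, is_open T U -> U x -> exists y, U y /\ A y.

Definition converges (s : nat -> X) (x : X) : Prop :=
  forall U, is_open T U -> U x -> exists N, forall n, (N <= n)%nat -> U (s n).

Definition compact_set (K : X -> Prop) : Prop :=
  forall C : (X -> Prop) -> Prop,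
    (forall U, C U -> is_open T U) ->
    (forall x, K x -> exists U, C U /\ U x) ->
    exists L : list (X -> Prop),
      (forall U, In U L -> C U) /\
      (forall x, K x -> exists U, In U L /\ U x).

Definition T1_space : Prop :=
  forall x y, x <> y -> exists U, is_open T U /\ U x /\ ~ U y.

Definition regular_space : Prop :=
  T1_space /\
  forall (C : X -> Prop) x, is_closed C -> ~ C x ->
    exists U V, is_open T U /\ is_open T V /\ U x /\
      (forall y, C y -> V y) /\ (forall y, ~ (U y /\ V y)).

Definition k_network (N : (X -> Prop) -> Prop) : Prop :=
  forall K U, compact_set K -> is_open T U -> (forall x, K x -> U x) ->
    exists F : list (X -> Prop),
      (forall A, In A F -> N A) /\
      (forall x, K x -> exists A, In A F /\ A x) /\
      (forall A, In A F -> forall x, A x -> U x).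

Definition locally_finite (N : (X -> Prop) -> Prop) : Prop :=
  forall x, exists U, is_open T U /\ U x /\
    exists L : list (X -> Prop),
      forall A, N A -> (exists y, U y /\ A y) -> In A L.

Definition sigma_locally_finite (N : (X -> Prop) -> Prop) : Prop :=
  exists Nn : nat -> (X -> Prop) -> Prop,
    (forall A, N A <-> exists n, Nn n A) /\
    (forall n, locally_finite (Nn n)).

Definition aleph_space : Prop :=
  regular_space /\ exists N, sigma_locally_finite N /\ k_network N.

Definition frechet_urysohn : Prop :=
  forall (A : X -> Prop) x, closure A x ->
    exists s : nat -> X, (forall n, A (s n)) /\ converges s x.

Definition alpha4_at (x : X) : Prop :=
  forall xs : nat -> nat -> X,
    (forall m, converges (xs m) x) ->
    exists (mk nk : nat -> nat),
      (forall i j, i <> j -> mk i <> mk j) /\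
      converges (fun k => xs (mk k) (nk k)) x.

Definition alpha4 : Prop := forall x, alpha4_at x.

Definition is_metric (d : X -> X -> R) : Prop :=
  (forall x y, 0 <= d x y) /\
  (forall x y, d x y = 0 <-> x = y) /\
  (forall x y, d x y = d y x) /\
  (forall x y z, d x z <= d x y + d y z).

Definition metrizable : Prop :=
  exists d : X -> X -> R, is_metric d /\
    forall U : X -> Prop, is_open T U <->
      (forall x, U x -> exists eps, 0 < eps /\ forall y, d x y < eps -> U y).

End Top.

(* Main.v *)
Require Import Defs.
From Stdlib Require Import Reals List.
From Stdlib Require Import Lra Lia Classical ClassicalEpsilon.
From Stdlib Require Import FunctionalExtensionality PropExtensionality.

Set Implicit Arguments.
Local Open Scope nat_scope.

(** Let [M n] be the family of closures of the members of the first [n] locally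
    finite parts of the k-network: it is locally finite and closed.  If [x] were
    outside the interior of the union of [{A in M n | A <= U}] for every [n], then
    Fréchet-Urysohn and (alpha_4) would give a sequence converging to [x] whose
    terms escape these unions for unboundedly many [n], against the k-network
    property of that sequence with its limit.  So these unions eventually are
    neighbourhoods of [x].

    Only finitely many members of [M n] contain [x], hence the points [z] lying
    in no member of [M n] that misses [x], and lying in the interior of every
    union of members through [x] which is a neighbourhood of [x], form an open
    set [V n x].  For [x] in [U] open and [n] large, [V n y <= U] for all [y] in
    [V n x], and [y] is in [U] whenever [V n x] meets [V n y].  These are the
    hypotheses of Frink's metrization theorem, which is proved by passing to a
    sequence of entourages with [D (k+1) o D (k+1) <= D k] and taking the infimum
    of the weights of chains. *)

(** * Open sets *)

Lemma pred_ext (A : Type) (P Q : A -> Prop) : (forall a, P a <-> Q a) -> P = Q.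
Proof.
  intros H; apply functional_extensionality; intros a.
  now apply propositional_extensionality.
Qed.

Lemma choice (A B : Type) (R : A -> B -> Prop) :
  (forall a, exists b, R a b) -> exists f : A -> B, forall a, R a (f a).
Proof.
  intros H.
  exists (fun a => proj1_sig (constructive_indefinite_description _ (H a))).
  intros a; apply proj2_sig.
Qed.

Section Open.
Variables (X : Type) (T : topology X).

Definition interior (S : X -> Prop) (x : X) : Prop :=
  exists V, is_open T V /\ V x /\ forall y, V y -> S y.

Lemma interior_sub (S : X -> Prop) x : interior S x -> S x.
Proof. intros (V & _ & Vx & sVS); auto. Qed.

Lemma open_of_interior (U : X -> Prop) :
  (forall x, U x -> interior U x) -> is_open T U.
Proof.
  intros H.
  replace U with
    (fun x => exists V, (is_open T V /\ forall y, V y -> U y) /\ V x).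
  - apply open_union; tauto.
  - apply pred_ext; intros x; split.
    + intros (V & [_ sVU] & Vx); auto.
    + intros Ux; destruct (H x Ux) as (V & oV & Vx & sVU); eauto.
Qed.

Lemma open_interior (S : X -> Prop) : is_open T (interior S).
Proof.
  apply open_of_interior; intros x (V & oV & Vx & sVS).
  exists V; repeat split; trivial; intros y Vy; exists V; auto.
Qed.

(** The filter [F] is there because local finiteness only yields a list containing the relevant
    sets; its other entries need not be open. *)
Lemma open_finite_intersection (L : list (X -> Prop)) (F : (X -> Prop) -> Prop) :
  (forall U, F U -> is_open T U) ->
  is_open T (fun x => forall U, In U L -> F U -> U x).
Proof.
  intros oF; induction L as [|V L IH].
  - replace (fun x : X => _) with (fun _ : X => True); [apply open_full|].
    apply pred_ext; simpl; tauto.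
  - destruct (classic (F V)) as [FV|nFV].
    + replace (fun x : X => _)
        with (fun x => V x /\ forall U, In U L -> F U -> U x).
      * apply open_inter; auto.
      * apply pred_ext; intros x; simpl; split.
        -- intros [Vx H] U [<-|iU] FU; [trivial|exact (H U iU FU)].
        -- intros H; split; [exact (H V (or_introl eq_refl) FV)|].
           intros U iU FU; exact (H U (or_intror iU) FU).
    + replace (fun x : X => _) with (fun x => forall U, In U L -> F U -> U x);
        trivial.
      apply pred_ext; intros x; simpl; split; intros H U iU FU.
      * destruct iU as [<-|iU]; [contradiction|exact (H U iU FU)].
      * exact (H U (or_intror iU) FU).
Qed.

Lemma closed_closure (A : X -> Prop) : is_closed T (closure T A).
Proof.
  apply open_of_interior; intros x nx.
  apply not_all_ex_not in nx; destruct nx as [U nU].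
  apply imply_to_and in nU; destruct nU as [oU nU].
  apply imply_to_and in nU; destruct nU as [Ux nU].
  exists U; repeat split; trivial.
  intros y Uy cy; apply nU, (cy U oU Uy).
Qed.

Lemma sub_closure (A : X -> Prop) x : A x -> closure T A x.
Proof. intros Ax U _ Ux; eauto. Qed.

Lemma regular_shrink (U : X -> Prop) x :
  regular_space T -> is_open T U -> U x ->
  exists V, is_open T V /\ V x /\
    forall A : X -> Prop, (forall y, A y -> V y) -> forall y, closure T A y -> U y.
Proof.
  intros [_ reg] oU Ux.
  destruct (reg (fun y => ~ U y) x) as (V & W & oV & oW & Vx & sW & dVW).
  - unfold is_closed; replace (fun y => ~ ~ U y) with U; trivial.
    apply pred_ext; intros y; split; [tauto|apply NNPP].
  - tauto.
  - exists V; repeat split; trivial.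
    intros A sAV y cAy; apply NNPP; intros nUy.
    destruct (cAy W oW (sW y nUy)) as (z & Wz & Az).
    apply (dVW z); auto.
Qed.

(** The member of a cover that contains the limit absorbs a tail; finitely many terms remain. *)
Lemma compact_convergent_sequence (s : nat -> X) x :
  converges T s x -> compact_set T (fun y => y = x \/ exists n, y = s n).
Proof.
  intros cs C oC cC.
  assert (segment : forall N, exists L : list (X -> Prop),
    (forall U, In U L -> C U) /\
    forall n, n < N -> exists U, In U L /\ U (s n)).
  { induction N as [|N (L & CL & HL)].
    - exists nil; split; [intros U []|lia].
    - destruct (cC (s N)) as (U & CU & Us); [eauto|].
      exists (U :: L); split.
      + intros V [<-|iV]; auto.
      + intros n Hn; destruct (Nat.eq_dec n N) as [->|ne].
        * exists U; simpl; auto.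
        * destruct (HL n) as (V & iV & Vs); [lia|]; exists V; simpl; auto. }
  destruct (cC x) as (U & CU & Ux); [auto|].
  destruct (cs U (oC U CU) Ux) as [N HN].
  destruct (segment N) as (L & CL & HL).
  exists (U :: L); split.
  - intros V [<-|iV]; auto.
  - intros y [->|[n ->]].
    + exists U; simpl; auto.
    + destruct (Nat.le_gt_cases N n) as [le|lt].
      * exists U; simpl; auto.
      * destruct (HL n lt) as (V & iV & Vs); exists V; simpl; auto.
Qed.

(** * Locally finite families *)

Lemma locally_finite_sub (N P : (X -> Prop) -> Prop) :
  (forall A, P A -> N A) -> locally_finite T N -> locally_finite T P.
Proof.
  intros sPN lfN x; destruct (lfN x) as (U & oU & Ux & L & HL).
  exists U; repeat split; trivial; exists L; auto.
Qed.

(** An open set meeting [closure T B] already meets [B], so the same neighbourhoods work. *)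
Lemma locally_finite_closure (N : (X -> Prop) -> Prop) :
  locally_finite T N ->
  locally_finite T (fun A => exists B, N B /\ A = closure T B).
Proof.
  intros lfN x; destruct (lfN x) as (U & oU & Ux & L & HL).
  exists U; repeat split; trivial; exists (map (closure T) L).
  intros A (B & NB & ->) (y & Uy & By).
  apply in_map, HL; trivial; exact (By U oU Uy).
Qed.

Lemma locally_finite_union_le (N : nat -> (X -> Prop) -> Prop) :
  (forall n, locally_finite T (N n)) ->
  forall n, locally_finite T (fun A => exists i, i <= n /\ N i A).
Proof.
  intros lfN n x; induction n as [|n (U & oU & Ux & L & HL)].
  - destruct (lfN 0 x) as (U & oU & Ux & L & HL).
    exists U; repeat split; trivial; exists L.
    intros A (i & le & NA); replace i with 0 in NA by lia; auto.
  - destruct (lfN (S n) x) as (V & oV & Vx & L' & HL').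
    exists (fun y => U y /\ V y); split; [now apply open_inter|].
    split; [auto|]; exists (L ++ L').
    intros A (i & le & NA) (y & [Uy Vy] & Ay); apply in_or_app.
    destruct (Nat.eq_dec i (S n)) as [->|ne].
    + right; eauto.
    + left; apply HL; [exists i; split; trivial; lia|eauto].
Qed.

(** Near [z] only finitely many members of [P] are met, so avoiding them is a finite intersection of
    open conditions. *)
Lemma open_avoiding_locally_finite (P : (X -> Prop) -> Prop) :
  locally_finite T P -> (forall A, P A -> is_closed T A) ->
  is_open T (fun z => forall A, P A -> ~ A z).
Proof.
  intros lfP clP; apply open_of_interior; intros z Hz.
  destruct (lfP z) as (U & oU & Uz & L & HL).
  pose (F := fun V : X -> Prop => exists A, P A /\ V = (fun y => ~ A y)).
  exists (fun y => U y /\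
    forall V, In V (map (fun (A : X -> Prop) y => ~ A y) L) -> F V -> V y).
  split; [|split].
  - apply open_inter; trivial; apply open_finite_intersection.
    intros V (A & PA & ->); exact (clP A PA).
  - split; trivial; intros V _ (A & PA & ->); auto.
  - intros y [Uy Hy] A PA Ay.
    apply (Hy (fun y => ~ A y)); trivial.
    + apply (in_map (fun (A : X -> Prop) y => ~ A y)), HL; eauto.
    + exists A; auto.
Qed.

End Open.

Lemma finite_powerset (A : Type) (L : list A) :
  exists LL : list (A -> Prop), forall P, (forall a, P a -> In a L) -> In P LL.
Proof.
  induction L as [|b L [LL HLL]].
  - exists ((fun _ => False) :: nil); intros P HP; left.
    apply pred_ext; intros a; split; [tauto|apply HP].
  - exists (LL ++ map (fun Q a => a = b \/ Q a) LL); intros P HP.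
    apply in_or_app; destruct (classic (P b)) as [Pb|nPb].
    + right; apply in_map_iff; exists (fun a => P a /\ a <> b); split.
      * apply pred_ext; intros a; split.
        -- intros [->|[Pa _]]; trivial.
        -- intros Pa; destruct (classic (a = b)); tauto.
      * apply HLL; intros a [Pa ne]; destruct (HP a Pa); [congruence|trivial].
    + left; apply HLL; intros a Pa; destruct (HP a Pa) as [->|]; [contradiction|trivial].
Qed.

(** * Metrization by chains *)

Section ChainMetric.
Variables (X : Type) (D : nat -> X -> X -> Prop).
Hypothesis D_refl : forall k x, D k x x.
Hypothesis D_sym : forall k x y, D k x y -> D k y x.
Hypothesis D_zero : forall x y, D 0 x y.
Hypothesis D_comp3 : forall k x y z w,
  D (S k) x y -> D (S k) y z -> D (S k) z w -> D k x w.

Let wt (k : nat) : R := ((/ 2) ^ k)%R.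

Lemma wt_pos k : (0 < wt k)%R.
Proof. apply pow_lt; lra. Qed.

Lemma wt_S k : (2 * wt (S k) = wt k)%R.
Proof. unfold wt; simpl; lra. Qed.

Lemma wt_antitone i j : i <= j -> (wt j <= wt i)%R.
Proof.
  intros le; induction le as [|j le IH]; [lra|].
  pose proof (wt_S j); pose proof (wt_pos (S j)); lra.
Qed.

Lemma D_antitone i j x y : i <= j -> D j x y -> D i x y.
Proof.
  intros le; induction le as [|j le IH]; trivial.
  intros Dxy; apply IH; eapply D_comp3; eauto.
Qed.

(** The length is carried along with the weight to allow strong induction when a chain is cut. *)
Inductive chain : X -> X -> nat -> R -> Prop :=
| chain_nil x : chain x x 0 0
| chain_cons x y z k n s :
    D k x y -> chain y z n s -> chain x z (S n) (wt k + s).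

Lemma chain_nonneg x y n s : chain x y n s -> (0 <= s)%R.
Proof.
  induction 1 as [|x y z k n s _ _ IH]; [lra|].
  pose proof (wt_pos k); lra.
Qed.

Lemma chain_app x y n s : chain x y n s ->
  forall z m t, chain y z m t -> exists p, chain x z p (s + t).
Proof.
  induction 1 as [x|x y z k n s Dxy _ IH]; intros w m t c.
  - exists m; now rewrite Rplus_0_l.
  - destruct (IH _ _ _ c) as [p c']; exists (S p).
    rewrite Rplus_assoc; econstructor; eauto.
Qed.

Lemma chain_one k x y : D k x y -> chain x y 1 (wt k).
Proof.
  intros H; rewrite <- (Rplus_0_r (wt k)); econstructor; eauto; constructor.
Qed.

Lemma chain_rev x y n s : chain x y n s -> exists m, chain y x m s.
Proof.
  induction 1 as [x|x y z k n s Dxy _ [m IH]].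
  - exists 0; constructor.
  - rewrite Rplus_comm; apply (chain_app IH (chain_one (D_sym Dxy))).
Qed.

(** The cut is made at the first link bringing the running weight to at least [c]. If none does, it
    is made at the last link and nothing remains after it, whence the case [s2 = 0]. *)
Lemma chain_split x y n s : chain x y n s -> 0 < n -> forall c, (0 < c)%R ->
  exists u v k n1 n2 s1 s2,
    chain x u n1 s1 /\ D k u v /\ chain v y n2 s2 /\
    n1 < n /\ n2 < n /\ (wt k <= s)%R /\
    (s1 < c)%R /\ (s2 = 0 \/ s2 <= s - c)%R.
Proof.
  induction 1 as [|x y z k n s Dxy c IH]; [lia|]; intros _ a apos.
  pose proof (wt_pos k); pose proof (chain_nonneg c).
  destruct (Rle_lt_dec a (wt k)) as [le|lt].
  { exists x, y, k, 0, n, 0%R, s.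
    repeat split; trivial; try lia; try lra; constructor. }
  destruct (Nat.eq_dec n 0) as [->|ne].
  { inversion c; subst.
    exists x, z, k, 0, 0, 0%R, 0%R.
    repeat split; trivial; try lia; try lra; constructor. }
  destruct (IH ltac:(lia) (a - wt k)%R ltac:(lra))
    as (u & v & j & n1 & n2 & s1 & s2 & c1 & Duv & c2 & ? & ? & ? & ? & ?).
  exists u, v, j, (S n1), n2, (wt k + s1)%R, s2.
  repeat split; trivial; try lia; try lra; econstructor; eauto.
Qed.

(* Cut the chain at its middle link: both remaining pieces weigh less than half. *)
Lemma chain_short n : forall x y s k, chain x y n s -> (s < wt k)%R -> D k x y.
Proof.
  induction n as [n IH] using (well_founded_induction Nat.lt_wf_0); intros x y s k c lt.
  destruct (Nat.eq_dec n 0) as [->|ne].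
  { inversion c; subst; auto. }
  pose proof (wt_S k); pose proof (wt_pos (S k)).
  destruct (chain_split c ltac:(lia) (wt_pos (S k)))
    as (u & v & j & n1 & n2 & s1 & s2 & c1 & Duv & c2 & ? & ? & ? & ? & ?).
  apply D_comp3 with u v.
  - apply (IH n1 ltac:(lia) x u s1); trivial.
  (* The middle link weighs at most [s < wt k], which forces [j > k]. *)
  - apply D_antitone with j; trivial.
    destruct (Nat.le_gt_cases (S k) j) as [|lt']; trivial.
    pose proof (@wt_antitone j k ltac:(lia)); lra.
  - apply (IH n2 ltac:(lia) v y s2); trivial; lra.
Qed.

Lemma chain_metric : exists d : X -> X -> R,
  (forall x y, (0 <= d x y)%R) /\ (forall x, d x x = 0%R) /\
  (forall x y, d x y = d y x) /\
  (forall x y z, (d x z <= d x y + d y z)%R) /\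
  (forall k x y, D k x y -> (d x y <= (/ 2) ^ k)%R) /\
  (forall k x y, (d x y < (/ 2) ^ k)%R -> D k x y).
Proof.
  assert (inf : forall p : X * X, exists r : R,
    (forall n s, chain (fst p) (snd p) n s -> (r <= s)%R) /\
    (forall b, (forall n s, chain (fst p) (snd p) n s -> (b <= s)%R) ->
       (b <= r)%R)).
  { intros [x y]; simpl.
    (* The infimum is minus the supremum of the negated weights; [D_zero] supplies a chain, so the
       set is inhabited. *)
    destruct (completeness (fun t => exists n, chain x y n (- t)))
      as [r [ub lub]].
    - exists 0%R; intros t [n c]; apply chain_nonneg in c; lra.
    - exists (- wt 0)%R, 1; rewrite Ropp_involutive; now apply chain_one.
    - exists (- r)%R; split.
      + intros n s c; enough (- s <= r)%R by lra.
        apply ub; exists n; now rewrite Ropp_involutive.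
      + intros b Hb; enough (r <= - b)%R by lra.
        apply lub; intros t [n c]; apply Hb in c; lra. }
  apply choice in inf; destruct inf as [f Hf].
  pose (d := fun x y => f (x, y)).
  assert (lb : forall x y n s, chain x y n s -> (d x y <= s)%R).
  { intros x y; exact (proj1 (Hf (x, y))). }
  assert (glb : forall x y b, (forall n s, chain x y n s -> (b <= s)%R) ->
    (b <= d x y)%R).
  { intros x y; exact (proj2 (Hf (x, y))). }
  assert (sym : forall x y, (d x y <= d y x)%R).
  { intros x y; apply glb; intros n s c.
    destruct (chain_rev c) as [m c']; eauto. }
  assert (nonneg : forall x y, (0 <= d x y)%R).
  { intros x y; apply glb; intros n s; apply chain_nonneg. }
  exists d; repeat split; trivial.
  - intros x; apply Rle_antisym; trivial; eapply lb; constructor.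
  - intros x y; apply Rle_antisym; trivial.
  - intros x y z.
    enough (d x z - d y z <= d x y)%R by lra.
    apply glb; intros n s c.
    enough (d x z - s <= d y z)%R by lra.
    apply glb; intros m t c'.
    destruct (chain_app c c') as [p c'']; apply lb in c''; lra.
  - intros k x y Dxy; eapply lb, chain_one, Dxy.
  - intros k x y lt; apply NNPP; intros nD.
    enough (wt k <= d x y)%R by (unfold wt in *; lra).
    apply glb; intros n s c.
    destruct (Rle_lt_dec (wt k) s) as [|lt']; trivial.
    destruct nD; eapply chain_short; eauto.
Qed.

End ChainMetric.

Lemma half_pow_lt (eps : R) : (0 < eps)%R -> exists k, ((/ 2) ^ k < eps)%R.
Proof.
  intros pos.
  destruct (pow_lt_1_zero (/ 2)%R ltac:(rewrite Rabs_pos_eq; lra) eps pos)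
    as [N HN].
  exists N; specialize (HN N (le_n N)).
  rewrite Rabs_pos_eq in HN; trivial; apply pow_le; lra.
Qed.

(** * Metrization from entourages and from Frink's condition *)

Section Metrization.
Variables (X : Type) (T : topology X).

Lemma metrizable_of_entourages (D : nat -> X -> X -> Prop) :
  T1_space T ->
  (forall k x, D k x x) -> (forall k x y, D k x y -> D k y x) ->
  (forall k x y z, D (S k) x y -> D (S k) y z -> D k x z) ->
  (forall k x, interior T (D k x) x) ->
  (forall U x, is_open T U -> U x -> exists k, forall y, D k x y -> U y) ->
  metrizable T.
Proof.
  intros t1 D_refl D_sym D_comp D_nbhd D_base.
  assert (D_anti : forall i j x y, i <= j -> D j x y -> D i x y).
  { intros i j x y le; induction le as [|j le IH]; trivial.
    intros Dxy; apply IH; eapply D_comp; eauto. }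
  (* Every second entourage turns [D o D <= D] into the ternary condition. *)
  pose (E := fun k x y => match k with 0 => True | S k => D (2 * k) x y end).
  destruct (@chain_metric X E)
    as (d & d_nonneg & d_refl & d_sym & d_tri & d_le & d_lt).
  - intros [|k] x; simpl; auto.
  - intros [|k] x y; simpl; auto.
  - simpl; auto.
  - intros [|k] x y z w Dxy Dyz Dzw; simpl; trivial.
    cbn [E] in *; replace (2 * S k) with (S (S (2 * k))) in * by lia.
    apply D_comp with z.
    + apply D_comp with y; trivial.
    + eapply D_anti; [|exact Dzw]; lia.
  - exists d; split; [repeat split; trivial|].
    + intros d0; apply NNPP; intros ne.
      destruct (t1 x y ne) as (U & oU & Ux & nUy).
      destruct (D_base U x oU Ux) as [k Hk].
      apply nUy, Hk, (D_anti k (2 * k)); [lia|].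
      apply (d_lt (S k)); rewrite d0; apply pow_lt; lra.
    + intros ->; apply d_refl.
    + intros U; split.
      * intros oU x Ux; destruct (D_base U x oU Ux) as [k Hk].
        (* Since [E (S k)] is [D (2 * k)], this radius forces [D (2 * k) x y], hence [D k x y]. *)
        exists ((/ 2) ^ S k)%R; split; [apply pow_lt; lra|].
        intros y lt; apply Hk, (D_anti k (2 * k)); [lia|].
        exact (d_lt (S k) x y lt).
      * intros HU; apply open_of_interior; intros x Ux.
        destruct (HU x Ux) as (eps & pos & Heps).
        destruct (half_pow_lt pos) as [k Hk].
        destruct (D_nbhd (2 * k) x) as (V & oV & Vx & sVD).
        exists V; repeat split; trivial; intros y Vy; apply Heps.
        pose proof (d_le (S k) x y (sVD y Vy)) as le; simpl in le.
        pose proof (pow_lt (/ 2) k ltac:(lra)); lra.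
Qed.

(* The index [m] depends on [x].  If the refined neighbourhoods of [x] and [y]
   meet, the one with the smaller index absorbs both at the preceding step. *)
Lemma metrizable_of_frink (nb : nat -> X -> X -> Prop) :
  T1_space T ->
  (forall n x, is_open T (nb n x)) -> (forall n x, nb n x x) ->
  (forall i j x y, i <= j -> nb j x y -> nb i x y) ->
  (forall U x, is_open T U -> U x -> exists m, forall y z,
     nb m x z -> nb m y z -> forall w, nb m y w -> U w) ->
  metrizable T.
Proof.
  intros t1 nb_open nb_refl nb_anti frink.
  assert (index : forall p : X * nat, exists m, forall y z,
    nb m (fst p) z -> nb m y z -> forall w, nb m y w -> nb (snd p) (fst p) w).
  { intros [x n]; apply frink; simpl; auto. }
  apply choice in index; destruct index as [g Hg].
  (* The [g] term makes level [S k] at [x] absorb into level [k]; the successor term ensures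
     [k <= f x k]. *)
  pose (f := fun x => fix f k :=
    match k with 0 => 0 | S k => Nat.max (g (x, f k)) (S (f k)) end).
  assert (f_ge : forall x k, k <= f x k).
  { intros x k; induction k as [|k IH]; simpl in *; lia. }
  assert (f_step : forall k x y z, f x (S k) <= f y (S k) ->
    nb (f x (S k)) x z -> nb (f y (S k)) y z ->
    forall w, nb (f y (S k)) y w -> nb (f x k) x w).
  { intros k x y z le xz yz w yw.
    assert (ge : g (x, f x k) <= f x (S k)) by (simpl; lia).
    apply (Hg (x, f x k) y z); simpl; eapply nb_anti; eauto; lia. }
  assert (f_anti : forall k x w, nb (f x (S k)) x w -> nb (f x k) x w).
  { intros k x w; apply nb_anti; simpl; lia. }
  apply metrizable_of_entourages
    (* Points are close when one refined neighbourhood contains both: symmetry is built in, and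
       composition is the case of two neighbourhoods that meet. *)
    with (fun k a b => exists x, nb (f x k) x a /\ nb (f x k) x b); trivial.
  - intros k x; exists x; auto.
  - intros k x y (c & ? & ?); exists c; auto.
  - intros k a b c (x & xa & xb) (y & yb & yc).
    destruct (Nat.le_ge_cases (f x (S k)) (f y (S k))) as [le|le].
    + exists x; split; [auto|exact (f_step k x y b le xb yb c yc)].
    + exists y; split; [exact (f_step k y x b le yb xb a xa)|auto].
  - intros k x; exists (nb (f x k) x); repeat split; trivial.
    intros y xy; exists x; auto.
  - intros U x oU Ux; destruct (frink U x oU Ux) as [m Hm].
    exists m; intros w (y & yx & yw).
    apply (Hm y x); trivial; eapply nb_anti; eauto.
Qed.

(** * Neighbourhoods from increasing closed locally finite families *)

Section ClosedNetwork.
Variable M : nat -> (X -> Prop) -> Prop.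
Hypothesis M_lf : forall n, locally_finite T (M n).
Hypothesis M_closed : forall n A, M n A -> is_closed T A.
Hypothesis M_mono : forall i j A, i <= j -> M i A -> M j A.

Let union (B : (X -> Prop) -> Prop) (x : X) : Prop := exists A, B A /\ A x.

Definition network_nbhd (n : nat) (x z : X) : Prop :=
  (forall A, M n A -> A z -> A x) /\
  (forall B, (forall A, B A -> M n A /\ A x) ->
     interior T (union B) x -> interior T (union B) z).

Lemma open_network_star n x : is_open T (fun z => forall A, M n A -> A z -> A x).
Proof.
  replace (fun z : X => _)
    with (fun z : X => forall A, M n A /\ ~ A x -> ~ A z).
  - apply open_avoiding_locally_finite.
    + apply locally_finite_sub with (M n); [tauto|trivial].
    + intros A [MA _]; eapply M_closed; eauto.
  - apply pred_ext; intros z; split.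
    + intros H A MA Az; apply NNPP; intros nAx; exact (H A (conj MA nAx) Az).
    + intros H A [MA nAx] Az; exact (nAx (H A MA Az)).
Qed.

Lemma open_network_nbhd n x : is_open T (network_nbhd n x).
Proof.
  apply open_inter; [apply open_network_star|].
  (* Every member of [M n] through [x] is in [L], so only finitely many subfamilies [B] arise and
     the second clause is a finite intersection. *)
  destruct (M_lf n x) as (U & oU & Ux & L & HL).
  destruct (finite_powerset L) as [LL HLL].
  pose (F := fun V => exists B : (X -> Prop) -> Prop,
    (forall A, B A -> M n A /\ A x) /\
    interior T (union B) x /\ V = interior T (union B)).
  replace (fun z : X => _) with (fun z => forall V,
    In V (map (fun B => interior T (union B)) LL) -> F V -> V z).
  - apply open_finite_intersection.
    intros V (B & _ & _ & ->); apply open_interior.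
  - apply pred_ext; intros z; split.
    + intros H B HB Bx; apply H; [|exists B; auto].
      apply (in_map (fun B => interior T (union B))), HLL.
      intros A BA; destruct (HB A BA) as [MA Ax]; eauto.
    + intros H V _ (B & HB & Bx & ->); auto.
Qed.

Lemma network_nbhd_antitone i j x z :
  i <= j -> network_nbhd j x z -> network_nbhd i x z.
Proof.
  intros le [H1 H2]; split.
  - intros A MA; apply H1; eauto.
  - intros B HB; apply H2; intros A BA; destruct (HB A BA); eauto.
Qed.

(* Near x only the members of M n through x are visible. *)
Lemma interior_union_through n (B : (X -> Prop) -> Prop) x :
  (forall A, B A -> M n A) -> interior T (union B) x ->
  interior T (union (fun A => B A /\ A x)) x.
Proof.
  intros sBM (V & oV & Vx & sVB).
  exists (fun z => V z /\ forall A, M n A -> A z -> A x); repeat split; trivial.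
  - apply open_inter; trivial; apply open_network_star.
  - intros z [Vz Hz]; destruct (sVB z Vz) as (A & BA & Az).
    exists A; repeat split; trivial; exact (Hz A (sBM A BA) Az).
Qed.

Hypothesis M_base : forall U x, is_open T U -> U x -> exists n,
  interior T (union (fun A => M n A /\ forall y, A y -> U y)) x.

(** The union of the members through [x] inside [U] is a neighbourhood of [x], hence of [y]. Keeping
    only its members through [y] preserves this, so it passes on to [z]. *)
Lemma network_nbhd_trans U x : is_open T U -> U x -> exists n, forall y z,
  network_nbhd n x y -> network_nbhd n y z -> U z.
Proof.
  intros oU Ux; destruct (M_base U x oU Ux) as [n Hn]; exists n.
  apply interior_union_through with (n := n) in Hn; [|tauto].
  intros y z [_ xy] [_ yz].
  apply xy in Hn; [|tauto].
  apply interior_union_through with (n := n) in Hn; [|tauto].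
  apply yz in Hn; [|tauto].
  apply interior_sub in Hn; destruct Hn as (A & [[[_ sAU] _] _] & Az); auto.
Qed.

(** The point [z] lies in some member inside [U], and a member containing [z] must contain [y]. *)
Lemma network_nbhd_meet U x : is_open T U -> U x -> exists n, forall y z,
  network_nbhd n x z -> network_nbhd n y z -> U y.
Proof.
  intros oU Ux; destruct (M_base U x oU Ux) as [n Hn]; exists n.
  apply interior_union_through with (n := n) in Hn; [|tauto].
  intros y z [_ xz] [yz _].
  apply xz in Hn; [|tauto].
  apply interior_sub in Hn; destruct Hn as (A & [[MA sAU] _] & Az).
  exact (sAU y (yz A MA Az)).
Qed.

Lemma metrizable_of_closed_network : T1_space T -> metrizable T.
Proof.
  intros t1; apply metrizable_of_frink with network_nbhd; trivial.
  - apply open_network_nbhd.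
  - intros n x; split; auto.
  - apply network_nbhd_antitone.
  - intros U x oU Ux.
    destruct (network_nbhd_trans U x oU Ux) as [n Hn].
    (* Taking the neighbourhood of [x] itself as the open set places [y] in it, which is what
       transitivity then requires. *)
    destruct (network_nbhd_meet (network_nbhd n x) x (open_network_nbhd n x)) as [m Hm].
    { split; auto. }
    exists (Nat.max n m); intros y z xz yz w yw.
    apply Hn with y.
    + apply Hm with z; apply network_nbhd_antitone with (Nat.max n m); trivial; lia.
    + apply network_nbhd_antitone with (Nat.max n m); trivial; lia.
Qed.

End ClosedNetwork.
End Metrization.

(** * The two implications *)

(** Pigeonhole: otherwise [n + 1] consecutive indices would map injectively below [n]. This is
    needed because (alpha_4) gives distinct indices, not increasing ones. *)
Lemma injective_nat_unbounded (m : nat -> nat) :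
  (forall i j, i <> j -> m i <> m j) ->
  forall N n, exists k, N <= k /\ n <= m k.
Proof.
  intros inj N n; apply NNPP; intros H.
  assert (le : length (map m (List.seq N (S n))) <= length (List.seq 0 n)).
  { apply NoDup_incl_length.
    - apply NoDup_map_NoDup_ForallPairs; [|apply seq_NoDup].
      intros i j _ _ eq; apply NNPP; intros ne; exact (inj i j ne eq).
    - intros a ia; apply in_map_iff in ia; destruct ia as (k & <- & ik).
      apply in_seq in ik; apply in_seq; split; [lia|].
      destruct (Nat.le_gt_cases n (m k)); [|lia].
      destruct H; exists k; lia. }
  rewrite length_map, !length_seq in le; lia.
Qed.

Section Implications.
Variables (X : Type) (T : topology X).

(** As [x] is in the closure of the complement of each [W n], a sequence outside [W n] converges to
    [x]; (alpha_4) selects a convergent sequence across these. *)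
Lemma sequential_neighbourhood (W : nat -> X -> Prop) x :
  frechet_urysohn T -> alpha4_at T x ->
  (forall n, ~ interior T (W n) x) ->
  exists (m : nat -> nat) (s : nat -> X),
    (forall i j, i <> j -> m i <> m j) /\ converges T s x /\
    forall k, ~ W (m k) (s k).
Proof.
  intros fu a4 nW.
  assert (H : forall n, exists t : nat -> X,
    (forall k, ~ W n (t k)) /\ converges T t x).
  { intros n; apply (fu (fun y => ~ W n y)).
    intros U oU Ux; apply NNPP; intros nU; apply (nW n).
    exists U; repeat split; trivial.
    intros y Uy; apply NNPP; intros nWy; apply nU; eauto. }
  apply choice in H; destruct H as [xs Hxs].
  destruct (a4 xs) as (mk & nk & inj & cv); [apply Hxs|].
  exists mk, (fun k => xs (mk k) (nk k)); repeat split; trivial.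
  intros k; apply Hxs.
Qed.

Lemma k_network_absorbs (N : nat -> (X -> Prop) -> Prop) U x :
  k_network T (fun A => exists n, N n A) ->
  frechet_urysohn T -> alpha4_at T x -> is_open T U -> U x ->
  exists n, interior T
    (fun z => exists A, (exists i, i <= n /\ N i A) /\
       (forall y, A y -> U y) /\ A z) x.
Proof.
  intros kN fu a4 oU Ux; apply NNPP; intros nn.
  destruct (sequential_neighbourhood (fun n z =>
    exists A, (exists i, i <= n /\ N i A) /\ (forall y, A y -> U y) /\ A z)
    fu a4) as (m & s & inj & cs & Hs); [intros n Hn; apply nn; eauto|].
  destruct (cs U oU Ux) as [k0 Hk0].
  (* Only a tail is used, so that the compact set lies inside [U]. *)
  assert (ct : converges T (fun k => s (k0 + k)) x).
  { intros V oV Vx; destruct (cs V oV Vx) as [k1 Hk1].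
    exists k1; intros k le; apply Hk1; lia. }
  destruct (kN _ U (compact_convergent_sequence ct) oU) as (F & FN & Fc & FU).
  { intros y [->|[k ->]]; trivial; apply Hk0; lia. }
  assert (level : exists n, forall A, In A F -> exists i, i <= n /\ N i A).
  { clear Fc FU; induction F as [|A F IH].
    - exists 0; intros A [].
    - destruct IH as [n Hn]; [intros B iB; apply FN; simpl; auto|].
      destruct (FN A (or_introl eq_refl)) as [i Ni].
      exists (Nat.max i n); intros B [<-|iB].
      + exists i; split; trivial; lia.
      + destruct (Hn B iB) as (j & le & Nj); exists j; split; trivial; lia. }
  destruct level as [n Hn].
  (* This term belongs to the tail, so a member of level at most [n <= m k] covers it, although it
     was chosen outside all such members. *)
  destruct (injective_nat_unbounded m inj k0 n) as (k & lek & lem).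
  destruct (Fc (s k)) as (A & iA & As).
  { right; exists (k - k0); f_equal; lia. }
  apply (Hs k); exists A; repeat split; [|exact (FU A iA)|trivial].
  destruct (Hn A iA) as (i & le & Ni); exists i; split; trivial; lia.
Qed.

Lemma aleph_metrizable :
  aleph_space T -> frechet_urysohn T -> alpha4 T -> metrizable T.
Proof.
  intros [reg (N & (Nn & NE & lf) & kN)] fu a4.
  replace N with (fun A => exists n, Nn n A) in kN
    by (apply pred_ext; intros A; symmetry; apply NE).
  pose (M := fun n A => exists i, i <= n /\ exists B, Nn i B /\ A = closure T B).
  apply metrizable_of_closed_network with M; [| | | |apply reg].
  - apply locally_finite_union_le; intros n.
    now apply locally_finite_closure.
  - intros n A (i & _ & B & _ & ->); apply closed_closure.
  - intros i j A le (l & le' & H); exists l; split; trivial; lia.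
  - intros U x oU Ux.
    (* Network members are sought inside the smaller [V], so that their closures stay in [U]. *)
    destruct (regular_shrink U x reg oU Ux) as (V & oV & Vx & HV).
    destruct (k_network_absorbs Nn V kN fu (a4 x) oV Vx) as (n & W & oW & Wx & HW).
    exists n, W; repeat split; trivial.
    intros y Wy; destruct (HW y Wy) as (A & (i & le & NA) & sAV & Ay).
    exists (closure T A); repeat split.
    + exists i; split; eauto.
    + exact (HV A sAV).
    + now apply sub_closure.
Qed.

(** Both properties of metrizable spaces reduce to choosing one point in each ball of radius
    [(/ 2) ^ n]. *)
Lemma metrizable_shrinking_balls : metrizable T -> forall x,
  exists B : nat -> X -> Prop,
    (forall n, is_open T (B n) /\ B n x) /\
    forall s : nat -> X, (forall n, B n (s n)) -> converges T s x.
Proof.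
  intros (d & (_ & d0 & _ & dtri) & HT) x.
  exists (fun n y => d x y < (/ 2) ^ n)%R; split.
  - intros n; split.
    + apply HT; intros y lt; exists ((/ 2) ^ n - d x y)%R; split; [lra|].
      intros z lt'; specialize (dtri x y z); lra.
    + rewrite (proj2 (d0 x x) eq_refl); apply pow_lt; lra.
  - intros s Hs U oU Ux.
    destruct (proj1 (HT U) oU x Ux) as (eps & pos & Heps).
    destruct (half_pow_lt pos) as [N HN].
    exists N; intros n le; apply Heps.
    apply Rlt_trans with ((/ 2) ^ n)%R; trivial.
    apply Rle_lt_trans with ((/ 2) ^ N)%R; trivial.
    exact (wt_antitone le).
Qed.

Lemma metrizable_frechet_urysohn : metrizable T -> frechet_urysohn T.
Proof.
  intros met A x cl.
  destruct (metrizable_shrinking_balls met x) as (B & HB & cvB).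
  destruct (choice (fun n y => B n y /\ A y)) as [s Hs].
  { intros n; apply cl; apply HB. }
  exists s; split; [|apply cvB]; intros n; apply Hs.
Qed.

Lemma metrizable_alpha4 : metrizable T -> alpha4 T.
Proof.
  intros met x xs cv.
  destruct (metrizable_shrinking_balls met x) as (B & HB & cvB).
  destruct (choice (fun m n => B m (xs m n))) as [nk Hnk].
  { intros m; destruct (HB m) as [oB Bx].
    destruct (cv m (B m) oB Bx) as [N HN]; exists N; auto. }
  exists (fun k => k), nk; split; trivial; now apply cvB.
Qed.

End Implications.

Theorem theorem2p2 (X : Type) (T : topology X) :
  aleph_space T -> (metrizable T <-> frechet_urysohn T /\ alpha4 T).
Proof.
  intros al; split.
  - intros met; split.
    + now apply metrizable_frechet_urysohn.
    + now apply metrizable_alpha4.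
  - intros [fu a4]; now apply aleph_metrizable.
Qed.
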